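(* Let $k,s,a,b\in\mathbb{R}$. (i) If there is a constant $c>0$ such that the estimate $\|uv\|_{X^S_{k,-a}}\le c\,\|u\|_{X^S_{k,b}}\|v\|_{X^B_{s,b}}$ holds for all $u,v$, then $k\le s$. (ii) If there is a constant $c>0$ such that the estimate $\|uv\|_{X^S_{k,-a}}\le c\,\|u\|_{X^S_{k,b}}\|v\|_{X^B_{s,b}}$ holds for all $u,v$, then $k+s\ge0$. (iii) If there is a constant $c>0$ such that the estimate $\|u_1\bar u_2\|_{X^B_{s,-a}}\le c\,\|u_1\|_{X^S_{k,b}}\|u_2\|_{X^S_{k,b}}$ holds for all $u_1,u_2$, then $s\le k$.
   Context: Fix a period $L>0$; all functions are $L$-periodic in $x$. Write $\langle a\rangle=1+|a|$ and $\gamma_L(n)=(2\pi/L)^2\sqrt{n^2+n^4}$ for $n\in\mathbb{Z}$. Let $\widetilde F(\tau,n)$ be the time-space Fourier transform: Fourier coefficients $\frac1L\int_0^L e^{-2\pi i n x/L}(\cdot)\,dx$ in $x$ ($n\in\mathbb{Z}$) and Fourier transform in $t\in\mathbb{R}$ with dual variable $\tau\in\mathbb{R}$. Let $\mathcal{Y}$ be the space of functions $F:[0,L]\times\mathbb{R}\to\mathbb{C}$ with $F(x,\cdot)$ in the Schwartz class $S(\mathbb{R})$ for each $x\in[0,L]$, and $F(\cdot,t)\in C^\infty([0,L])$ ($L$-periodic) for each $t\in\mathbb{R}$. For $s,b\in\mathbb{R}$, the spaces $X^S_{s,b}$ and $X^B_{s,b}$ are the completions of $\mathcal{Y}$ with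 respect to the norms $$\|F\|_{X^S_{s,b}}=\big\|\langle\tau+(2\pi n/L)^2\rangle^b\langle n\rangle^s\widetilde F(\tau,n)\big\|_{\ell^2_nL^2_\tau},\qquad \|F\|_{X^B_{s,b}}=\big\|\langle|\tau|-\gamma_L(n)\rangle^b\langle n\rangle^s\widetilde F(\tau,n)\big\|_{\ell^2_nL^2_\tau}.$$ The bilinear estimates are understood as inequalities for all functions in $\mathcal{Y}$ with finite norms on the right-hand side (extended by density to the completions). *)

(* Defs.v *)
From HB Require Import structures.
From mathcomp Require Import all_boot all_order all_algebra.
From mathcomp Require Import all_classical all_reals all_analysis.
From mathcomp Require Import complex.

Set Implicit Arguments.
Unset Strict Implicit.
Unset Printing Implicit Defensive.

Import Order.TTheory GRing.Theory Num.Theory.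
Import numFieldNormedType.Exports.

Local Open Scope classical_set_scope.
Local Open Scope ring_scope.

Definition smooth {R : realType} (f : R -> R) : Prop :=
  forall (n : nat) (x : R), derivable (derive1n n f) x 1.

Definition csmooth {R : realType} (f : R -> R[i]) : Prop :=
  smooth (fun x => complex.Re (f x)) /\ smooth (fun x => complex.Im (f x)).

Definition schwartz {R : realType} (f : R -> R) : Prop :=
  smooth f /\
  forall m n : nat, exists C : R, forall t : R, `|t ^+ m * derive1n n f t| <= C.

Definition cschwartz {R : realType} (f : R -> R[i]) : Prop :=
  schwartz (fun t => complex.Re (f t)) /\ schwartz (fun t => complex.Im (f t)).

(* F x t, with space variable x and time variable t.  An L-periodic function on
   [0, L] is represented by its L-periodic extension to the whole line. *)
Definition spaceY {R : realType} (L : R) (F : R -> R -> R[i]) : Prop :=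
  [/\ forall x t : R, F (x + L) t = F x t,
      forall x : R, cschwartz (fun t => F x t) &
      forall t : R, csmooth (fun x => F x t)].

Definition cintegral {R : realType} (D : set R) (f : R -> R[i]) : R[i] :=
  Complex (\int[@lebesgue_measure R]_(x in D) complex.Re (f x))
          (\int[@lebesgue_measure R]_(x in D) complex.Im (f x)).

Definition cintegrable {R : realType} (D : set R) (f : R -> R[i]) : Prop :=
  (@lebesgue_measure R).-integrable D (fun x => (complex.Re (f x))%:E) /\
  (@lebesgue_measure R).-integrable D (fun x => (complex.Im (f x))%:E).

Definition expi {R : realType} (theta : R) : R[i] :=
  Complex (cos theta) (sin theta).

Definition fourier_coef {R : realType} (L : R) (F : R -> R -> R[i])
    (n : int) (t : R) : R[i] :=
  real_complex R (L^-1) *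
  cintegral `[0, L] (fun x => expi (- (2 * pi * n%:~R * x / L)) * F x t).

(* In time the transform is the integral of e^{-i t tau} against the function,
   without a factor 2 pi in the exponent: this is the convention for which the
   free Schroedinger evolution e^{i (2 pi n x / L - (2 pi n / L)^2 t)} sits at
   tau = - (2 pi n / L)^2. *)
Definition fourier_transform {R : realType} (L : R) (F : R -> R -> R[i])
    (tau : R) (n : int) : R[i] :=
  cintegral setT (fun t => expi (- (t * tau)) * fourier_coef L F n t).

(* Membership in Y does not make the Fourier coefficients integrable in t, since
   the decay in t need not be uniform in x. *)
Definition transformable {R : realType} (L : R) (F : R -> R -> R[i]) : Prop :=
  forall n : int, cintegrable setT (fourier_coef L F n).

Definition bracket {R : realType} (a : R) : R := 1 + `|a|.

Definition gammaL {R : realType} (L : R) (n : int) : R :=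
  (2 * pi / L) ^+ 2 * Num.sqrt (n%:~R ^+ 2 + n%:~R ^+ 4).

(* +oo when F has no time-space Fourier transform, since the integrals above
   would then be default values. *)
Definition weighted_norm {R : realType} (L : R) (w : R -> int -> R)
    (F : R -> R -> R[i]) : \bar R :=
  if `[< transformable L F >] then
    ((\esum_(n in [set: int])
       (Lnorm (@lebesgue_measure R) 2%:E (fun tau =>
          (w tau n * Normc.normc (fourier_transform L F tau n))%:E)
        `^ 2)%E)
     `^ 2^-1)%E
  else +oo%E.

Definition XS_norm {R : realType} (L s b : R) (F : R -> R -> R[i]) : \bar R :=
  weighted_norm L
    (fun tau n => bracket (tau + (2 * pi * n%:~R / L) ^+ 2) `^ b *
                  bracket (n%:~R) `^ s) F.

Definition XB_norm {R : realType} (L s b : R) (F : R -> R -> R[i]) : \bar R :=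
  weighted_norm L
    (fun tau n => bracket (`|tau| - gammaL L n) `^ b *
                  bracket (n%:~R) `^ s) F.

(* Main.v *)
Require Import Defs.
From HB Require Import structures.
From mathcomp Require Import all_boot all_order all_algebra.
From mathcomp Require Import all_classical all_reals all_analysis.
From mathcomp Require Import measurable_realfun.
From mathcomp Require Import complex.
From mathcomp Require Import zify ring lra.

Set Implicit Arguments.
Unset Strict Implicit.
Unset Printing Implicit Defensive.

Import Order.TTheory GRing.Theory Num.Theory.
Import numFieldNormedType.Exports.

Local Open Scope classical_set_scope.
Local Open Scope ring_scope.

(** Every hypothesis is tested on Gaussian wave packets

      wave m om c x t = exp (- c t^2) exp (i (2 pi m x / L + om t)),

    which carry a single space frequency m and are concentrated in time
    frequency within O(1) of om.  Two facts make them convenient.  Products and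
    conjugates of packets are packets (waveM, wave_conj), so both sides of each
    estimate are norms of packets.  And their transform is explicit: it vanishes
    off the space frequency m, and at m it is the Gaussian
    sqrt (pi / c) exp (- (tau - om)^2 / (4 c)) (fourier_transform_wave).

    If moreover the modulation weight, seen as a function of tau, stays within
    a fixed distance D of |tau - om|, the Gaussian absorbs it whatever the
    exponent b, and the norm of the packet is comparable to (1 + |m|)^s with
    constants that depend neither on m nor on om (weighted_norm_wave_bounds).
    For the Schroedinger norm this holds on the parabola
    om = - (2 pi m / L)^2; for the Boussinesq norm it holds as soon as
    |om| = (2 pi m / L)^2, because gamma_L (m) differs from (2 pi m / L)^2 by a
    bounded amount (gammaL_wavenumber).

    It remains to choose interactions in which both factors and the product lie
    on their respective curves, so that no power of the modulations enters and
    the exponents a and b become irrelevant.  With h = (2 pi N / L)^2, the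
    (space, time) frequencies are

      (0, 0)   times (N, -h)             gives (N, -h),  so <N>^k <= C <N>^s;
      (N, -h)  times (-N, h)             gives (0, 0),   so 1 <= C <N>^(k + s);
      (N, -h)  times conjugate of (0, 0) gives (N, -h),  so <N>^s <= C <N>^k.

    Letting N grow compares the exponents (powR_bracket_le_exponent). *)

(** * Gaussians times trigonometric polynomials *)

Section gaussian.
Variable R : realType.
Implicit Types c t x om th : R.

Definition gauss c t := expR (- (c * t ^+ 2)).

Lemma gauss_gt0 c t : 0 < gauss c t. Proof. exact: expR_gt0. Qed.
Lemma gauss_ge0 c t : 0 <= gauss c t. Proof. exact: expR_ge0. Qed.

Lemma gauss0 t : gauss 0 t = 1. Proof. by rewrite /gauss mul0r oppr0 expR0. Qed.

Lemma gaussD c1 c2 t : gauss (c1 + c2) t = gauss c1 t * gauss c2 t.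
Proof. by rewrite /gauss -expRD mulrDl opprD. Qed.

Lemma is_derive_gauss c t :
  is_derive t (1 : R) (gauss c) (- (2 * c * t) * gauss c t).
Proof.
have d : is_derive t (1 : R) (fun x => - (c * x ^+ 2)) (- (2 * c * t)).
  apply: is_derive_eq.
  by rewrite /GRing.scale /=; ring.
have := @is_derive1_comp _ expR _ t _ _ (is_derive_expR _) d.
by move=> h; apply: is_derive_eq h _; rewrite mulrC.
Qed.

Lemma is_derive_phase om th t :
  is_derive t (1 : R) (fun x => om * x + th) om.
Proof. by apply: is_derive_eq; rewrite /GRing.scale /=; ring. Qed.

Lemma is_derive_cos_phase om th t :
  is_derive t (1 : R) (fun x => cos (om * x + th)) (- om * sin (om * t + th)).
Proof.
have h := @is_derive1_comp _ (@cos R) _ t _ _ (is_derive_cos _)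
  (is_derive_phase om th t).
by apply: is_derive_eq h _; ring.
Qed.

Lemma is_derive_sin_phase om th t :
  is_derive t (1 : R) (fun x => sin (om * x + th)) (om * cos (om * t + th)).
Proof.
have h := @is_derive1_comp _ (@sin R) _ t _ _ (is_derive_sin _)
  (is_derive_phase om th t).
by apply: is_derive_eq h _; ring.
Qed.

(** A family closed under differentiation in t, which is what makes the
    smoothness and decay of wave packets a matter of polynomial coefficients.
    The phase th lets it contain both cosines and sines, and c = 0 covers the
    undamped dependence on the space variable. *)
Definition gauss_trig c om th (P Q : {poly R}) t :=
  gauss c t * (P.[t] * cos (om * t + th) + Q.[t] * sin (om * t + th)).

Lemma is_derive_gauss_trig c om th P Q t :
  is_derive t (1 : R) (gauss_trig c om th P Q)
    (gauss_trig c om th (deriv P + om *: Q - (2 * c) *: ('X * P))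
                        (deriv Q - om *: P - (2 * c) *: ('X * Q)) t).
Proof.
have dg := is_derive_gauss c t.
have dc := is_derive_cos_phase om th t.
have ds := is_derive_sin_phase om th t.
have h := is_deriveM dg
  (is_deriveD (is_deriveM (is_derive_poly P t) dc)
              (is_deriveM (is_derive_poly Q t) ds)).
apply: is_derive_eq h _.
rewrite /gauss_trig !hornerD !hornerN !hornerZ !hornerM !hornerX !fctE.
by rewrite /GRing.scale /=; ring.
Qed.

Lemma derive1n_gauss_trig c om th n P Q : exists P' Q',
  derive1n n (gauss_trig c om th P Q) = gauss_trig c om th P' Q'.
Proof.
elim: n P Q => [|n ih] P Q; first by exists P, Q.
rewrite derive1Sn.
have -> : derive1 (gauss_trig c om th P Q) =
  gauss_trig c om th (deriv P + om *: Q - (2 * c) *: ('X * P))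
                     (deriv Q - om *: P - (2 * c) *: ('X * Q)).
  apply/funext => t; rewrite derive1E.
  by have [_ ->] := is_derive_gauss_trig c om th P Q t.
exact: ih.
Qed.

Lemma smooth_gauss_trig c om th P Q : smooth (gauss_trig c om th P Q).
Proof.
move=> n x; have [P' [Q' ->]] := derive1n_gauss_trig c om th n P Q.
by have [] := is_derive_gauss_trig c om th P' Q' x.
Qed.

(** The exponential series bounds exp (c t^2) from below by the term of
    order n + 1, and |t|^n is at most 1 + t^(2 (n + 1)). *)
Lemma exp_gauss_bounded c n : 0 < c ->
  exists C, 0 < C /\ forall t, `|t| ^+ n * gauss c t <= C.
Proof.
move=> c0; exists (1 + n.+1`!%:R / c ^+ n.+1).
have f0 : (0 : R) < n.+1`!%:R by rewrite ltr0n fact_gt0.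
have cn0 : 0 < c ^+ n.+1 by exact: exprn_gt0.
split=> [|t]; first by rewrite addr_gt0// divr_gt0.
set K := _ / _.
have h1 : (c * t ^+ 2) ^+ n.+1 / n.+1`!%:R <= expR (c * t ^+ 2).
  apply: le_trans (expR_ge1Dxn n _); first by rewrite lerDr.
  by rewrite mulr_ge0 ?sqr_ge0// ltW.
have h2 : `|t| ^+ n <= 1 + (t ^+ 2) ^+ n.+1.
  rewrite -real_normK ?num_real// -exprM.
  have [t1|t1] := lerP `|t| 1.
    by rewrite (le_trans (exprn_ile1 _ (normr_ge0 _) t1))// lerDl exprn_ge0.
  rewrite ler_wpDl// ler_weXn2l ?ltW//; lia.
have h3 : (t ^+ 2) ^+ n.+1 <= K * expR (c * t ^+ 2).
  rewrite exprMn in h1.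
  rewrite ler_pdivrMr// in h1; rewrite -(ler_pM2l cn0).
  by rewrite mulrA (mulrC _ K) divfK ?gt_eqF// [leRHS]mulrC.
rewrite /gauss expRN ler_pdivrMr ?expR_gt0// mulrDl mul1r (le_trans h2)//.
by rewrite lerD// -expR0 ler_expR mulr_ge0 ?sqr_ge0// ltW.
Qed.

Lemma horner_gauss_bounded c (P : {poly R}) : 0 < c ->
  exists C, forall t, `|P.[t]| * gauss c t <= C.
Proof.
move=> c0.
exists (\sum_(i < size P) `|P`_i| * projT1 (cid (exp_gauss_bounded i c0))).
move=> t; rewrite horner_coef.
apply: le_trans (ler_wpM2r (gauss_ge0 c t) (ler_norm_sum _ _ _)) _.
rewrite mulr_suml ler_sum// => i _.
rewrite normrM normrX -mulrA ler_wpM2l//.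
by case: cid => C /= [_ ]; apply.
Qed.

Lemma schwartz_gauss_trig c om th P Q : 0 < c ->
  schwartz (gauss_trig c om th P Q).
Proof.
move=> c0; split; first exact: smooth_gauss_trig.
move=> m n; have [P' [Q' ->]] := derive1n_gauss_trig c om th n P Q.
have [C1 hC1] := horner_gauss_bounded ('X^m * P') c0.
have [C2 hC2] := horner_gauss_bounded ('X^m * Q') c0.
exists (C1 + C2) => t; rewrite /gauss_trig.
rewrite [X in `|X|](_ : _ =
   ('X^m * P').[t] * gauss c t * cos (om * t + th) +
   ('X^m * Q').[t] * gauss c t * sin (om * t + th)); last first.
  by rewrite !hornerM !hornerXn; ring.
rewrite (le_trans (ler_normD _ _))// lerD//.
- rewrite !normrM [`|gauss c t|]ger0_norm ?gauss_ge0//.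
  apply: le_trans (hC1 t).
  by rewrite ler_piMr ?mulr_ge0 ?gauss_ge0// cos_max.
- rewrite !normrM [`|gauss c t|]ger0_norm ?gauss_ge0//.
  apply: le_trans (hC2 t).
  by rewrite ler_piMr ?mulr_ge0 ?gauss_ge0// sin_max.
Qed.

Lemma continuous_gauss c : continuous (gauss c).
Proof.
move=> t; apply/differentiable_continuous/derivable1_diffP.
by have [] := is_derive_gauss c t.
Qed.

Lemma continuous_gauss_trig c om th P Q : continuous (gauss_trig c om th P Q).
Proof.
move=> t; apply/differentiable_continuous/derivable1_diffP.
by have [] := is_derive_gauss_trig c om th P Q t.
Qed.

End gaussian.

(** * Integrals of Gaussians *)

Section gauss_integrals.
Variable R : realType.
Implicit Types c t x om th : R.
Let mu := @lebesgue_measure R.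

(** This is the total mass of a normal density of variance 1 / (2 c), whose
    mean m is arbitrary. *)
Lemma integral_gauss_center c m : 0 < c ->
  (\int[mu]_t (gauss c (t - m))%:E)%E = (Num.sqrt (pi / c))%:E.
Proof.
move=> c0; pose s := Num.sqrt ((2 * c)^-1).
have c2 : 0 < (2 * c)^-1 by rewrite invr_gt0 mulr_gt0.
have s0 : s != 0 by rewrite gt_eqF// sqrtr_gt0.
have s2 : s ^+ 2 = (2 * c)^-1 by rewrite sqr_sqrtr// ltW.
have pk : normal_peak s = (Num.sqrt (pi / c))^-1.
  rewrite /normal_peak s2; congr (Num.sqrt _)^-1.
  by rewrite -mulr_natr; field; rewrite gt_eqF.
have cp : 0 < Num.sqrt (pi / c) by rewrite sqrtr_gt0 divr_gt0// pi_gt0.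
have E t : (gauss c (t - m))%:E =
    ((Num.sqrt (pi / c))%:E * (normal_pdf m s t)%:E)%E.
  rewrite normal_pdfE// pk -EFinM mulVKf ?gt_eqF//.
  rewrite /normal_fun s2 /gauss; congr (expR _)%:E.
  by rewrite -mulr_natr; field; rewrite gt_eqF.
under eq_integral do rewrite E.
rewrite integralZl//; last exact: integrable_normal_pdf.
by rewrite integral_normal_pdf mule1.
Qed.

Lemma integral_gauss c : 0 < c ->
  (\int[mu]_t (gauss c t)%:E)%E = (Num.sqrt (pi / c))%:E.
Proof.
move=> c0; rewrite -(integral_gauss_center 0 c0).
by apply: eq_integral => t _; rewrite subr0.
Qed.

Lemma measurable_gauss c : measurable_fun setT (gauss c).
Proof. by apply: continuous_measurable_fun; exact: continuous_gauss. Qed.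

Lemma integrable_gauss c : 0 < c -> mu.-integrable setT (EFin \o gauss c).
Proof.
move=> c0; apply/integrableP; split.
  by apply/measurable_EFinP; exact: measurable_gauss.
under eq_integral do rewrite /= ger0_norm ?gauss_ge0//.
by rewrite integral_gauss// ltry.
Qed.

(** Half of the Gaussian bounds the polynomial factors; the other half is
    integrable. *)
Lemma integrable_gauss_trig c om th P Q : 0 < c ->
  mu.-integrable setT (EFin \o gauss_trig c om th P Q).
Proof.
move=> c0.
have c20 : 0 < c / 2 by rewrite divr_gt0.
have [C1 hC1] := horner_gauss_bounded P c20.
have [C2 hC2] := horner_gauss_bounded Q c20.
have := integrable_gauss c20 => /(@integrableZl _ _ _ mu _ measurableT (C1 + C2)).
apply: le_integrable => //.
  apply/measurable_EFinP; apply: continuous_measurable_fun.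
  exact: continuous_gauss_trig.
move=> t _; rewrite lee_fin /gauss_trig.
rewrite [c in gauss c](_ : c = c / 2 + c / 2); last by field.
rewrite gaussD -mulrA [leLHS]normrM [leRHS]normrM mulrC.
rewrite ler_wpM2r//.
apply: le_trans (ler_norm _); rewrite mulrDr (le_trans (ler_normD _ _))// lerD//.
- rewrite !normrM ger0_norm ?gauss_ge0// mulrA [_ * `|P.[t]|]mulrC.
  by apply: le_trans (hC1 t); rewrite ler_piMr ?mulr_ge0 ?gauss_ge0// cos_max.
- rewrite !normrM ger0_norm ?gauss_ge0// mulrA [_ * `|Q.[t]|]mulrC.
  by apply: le_trans (hC2 t); rewrite ler_piMr ?mulr_ge0 ?gauss_ge0// sin_max.
Qed.

Lemma cvg_integral_itvNnn (f : R -> R) :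
  mu.-integrable setT (EFin \o f) ->
  (\int[mu]_(t in `[(- n%:R)%R, n%:R%R]) (f t)%:E)%E @[n --> \oo] -->
  (\int[mu]_t (f t)%:E)%E.
Proof.
move=> intf; have /measurable_int mf := intf.
pose D n := `[- n%:R : R, n%:R]%classic.
under eq_fun do rewrite integral_mkcond.
have [] := @dominated_convergence _ _ _ mu setT measurableT
  (fun n => (EFin \o f) \_ (D n)) (EFin \o f) (fun t => `|(f t)%:E|%E) _ mf.
- move=> n; apply/(measurable_restrictT _ _).1; first exact: measurable_itv.
  exact: measurable_funTS.
- apply: aeW => t _; apply: cvg_near_cst.
  near=> n; rewrite patchE mem_set// /D /= in_itv/= -ler_norml.
  by near: n; exact: nbhs_infty_ger.
- exact: integrable_abse.
- apply: aeW => t n _; rewrite patchE; case: ifP => _ //=.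
  by rewrite normr0 lee_fin.
by [].
Unshelve. all: end_near. Qed.

(** Integration by parts on the whole line: apply the fundamental theorem of
    calculus on [-n, n] and let n grow. *)
Lemma integral_derivative_eq0 (F f : R -> R) :
  (forall t, is_derive t (1 : R) F (f t)) -> continuous f ->
  mu.-integrable setT (EFin \o f) ->
  F n%:R @[n --> \oo] --> (0 : R) -> F (- n%:R) @[n --> \oo] --> (0 : R) ->
  \int[mu]_t f t = 0.
Proof.
move=> dF cf intf Fp Fm.
have cF : continuous F.
  by move=> t; apply/differentiable_continuous/derivable1_diffP; case: (dF t).
suff h : ((\int[mu]_(t in `[(- n%:R)%R, n%:R%R]) (f t)%:E)%E @[n --> \oo] --> 0%:E)%E.
  have := cvg_unique _ (cvg_integral_itvNnn intf) h.
  by rewrite /Rintegral => ->.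
have FF : ((F n%:R - F (- n%:R))%:E @[n --> \oo] --> 0%:E)%E.
  apply: cvg_EFin; first exact: nearW.
  by rewrite -[X in _ --> X](subr0 0); exact: cvgB Fp Fm.
apply: cvg_trans FF; apply: near_eq_cvg; near=> n.
have n0 : (0 < n%:R :> R) by near: n; exact: nbhs_infty_gtr.
rewrite EFinB -(@continuous_FTC2 _ f)//.
- by rewrite (lt_trans _ n0)// oppr_lt0.
- exact: continuous_subspaceT.
- split.
  + by move=> x _; case: (dF x).
  + exact/cvg_at_right_filter/cF.
  + exact/cvg_at_left_filter/cF.
- by move=> x _; rewrite derive1E; case: (dF x).
Unshelve. all: end_near. Qed.

End gauss_integrals.

(** * The Fourier transform of a Gaussian *)

Section gauss_fourier.
Variables (R : realType) (c : R).
Hypothesis c0 : 0 < c.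
Implicit Types t x om th tau : R.
Let mu := @lebesgue_measure R.

(** The boundary terms of the integration by parts below; the sign (-1)^e
    treats both ends of the line at once. *)
Lemma cvg_gauss_sin om th (e : bool) :
  gauss c ((-1) ^+ e * n%:R) * sin (om * ((-1) ^+ e * n%:R) + th)
    @[n --> \oo] --> (0 : R).
Proof.
have [C [C0 hC]] := exp_gauss_bounded 1 c0.
apply/cvgr0Pnorm_le => eps eps0; near=> n.
have n0 : (0 < n%:R :> R) by near: n; exact: nbhs_infty_gtr.
set y := _ * n%:R; have yn : `|y| = n%:R.
  by rewrite normrM normrX normrN1 expr1n mul1r ger0_norm.
rewrite normrM (ger0_norm (gauss_ge0 _ _)).
apply: (@le_trans _ _ (gauss c y)); first by rewrite ler_piMr ?gauss_ge0// sin_max.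
have := hC y; rewrite expr1 yn => h; rewrite -(ler_pM2l n0) (le_trans h)//.
by rewrite -ler_pdivrMr//; near: n; exact: nbhs_infty_ger.
Unshelve. all: end_near. Qed.

Definition gauss_cos_transform th om :=
  \int[mu]_t gauss_trig c om th 1 0 t.

(** Differentiation under the integral sign, the derivative in om being
    dominated by |t| exp (- c t^2). *)
Lemma is_derive_gauss_cos_transform th om :
  is_derive om (1 : R) (gauss_cos_transform th)
    (\int[mu]_t gauss_trig c om th 0 (- 'X) t).
Proof.
pose f x t := gauss_trig c x th 1 0 t.
have df x y : is_derive x (1 : R) (f ^~ y) (gauss_trig c x th 0 (- 'X) y).
  have h := is_derive_cos_phase y th x.
  rewrite (_ : f ^~ y = fun x => gauss c y *: cos (y * x + th)); last first.
    apply/funext => z; rewrite /f /gauss_trig horner0 hornerC mul0r addr0 mul1r.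
    by rewrite (mulrC z y).
  apply: is_derive_eq (is_deriveZ (gauss c y) h) _.
  rewrite /gauss_trig horner0 mul0r add0r hornerN hornerX /GRing.scale /=.
  by rewrite (mulrC y x).
have f1 x y : partial1of2 f x y = gauss_trig c x th 0 (- 'X) y.
  by rewrite partial1of2E; have [_ ->] := df x y.
have Iom : `]om - 1, om + 1[%classic om.
  by rewrite /= in_itv/= ltrBlDr ltrDl ltr01.
have H1 x : `]om - 1, om + 1[%classic x -> mu.-integrable setT (EFin \o f x).
  by move=> _; exact: integrable_gauss_trig.
have H2 x y : `]om - 1, om + 1[%classic x -> [set: R] y -> derivable (f ^~ y) x 1.
  by move=> _ _; have [] := df x y.
pose G y := `|gauss_trig c 0 0 'X 0 y|.
have H3 y : 0 <= G y by exact: normr_ge0.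
have H4 : mu.-integrable setT (EFin \o G).
  exact: integrable_abse (integrable_gauss_trig 0 0 'X 0 c0).
have H5 x y : `]om - 1, om + 1[%classic x -> [set: R] y ->
    `|partial1of2 f x y| <= G y.
  move=> _ _; rewrite f1 /G /gauss_trig !horner0 !(mul0r, add0r, addr0) cos0 mulr1.
  rewrite hornerN hornerX !normrM normrN ler_wpM2l// ler_piMr//.
  exact: sin_max.
have D := derivable_under_integral measurableT Iom H1 H2 H3 H4 H5.
have E := differentiation_under_integral measurableT Iom H1 H2 H3 H4 H5.
apply: DeriveDef; first exact: D.
rewrite -derive1E E; apply: eq_Rintegral => y _; exact: f1.
Qed.

(** Since the derivative in t of exp (- c t^2) sin (om t + th) has integral
    zero, the derivative of the transform is - om / (2 c) times the transform. *)
Lemma gauss_cos_transform_ode th om :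
  \int[mu]_t gauss_trig c om th 0 (- 'X) t =
  - (om / (2 * c)) * gauss_cos_transform th om.
Proof.
have dF t : is_derive t (1 : R) (gauss_trig c om th 0 1)
    (gauss_trig c om th om%:P (- ((2 * c) *: 'X)) t).
  apply: is_derive_eq (is_derive_gauss_trig c om th 0 1 t) _.
  congr gauss_trig.
    by rewrite deriv0 add0r mulr0 scaler0 subr0 alg_polyC.
  by rewrite derivC scaler0 subr0 mulr1 sub0r.
have E e : (fun n => gauss_trig c om th 0 1 ((-1) ^+ e * n%:R)) =
   (fun n => gauss c ((-1) ^+ e * n%:R) * sin (om * ((-1) ^+ e * n%:R) + th)).
  by apply/funext => n; rewrite /gauss_trig horner0 hornerC mul0r add0r mul1r.
have := integral_derivative_eq0 dF.
rewrite (_ : (fun n => gauss_trig c om th 0 1 n%:R) =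
   (fun n => gauss_trig c om th 0 1 ((-1) ^+ false * n%:R))); last first.
  by apply/funext => n; rewrite expr0 mul1r.
rewrite (_ : (fun n => gauss_trig c om th 0 1 (- n%:R)) =
   (fun n => gauss_trig c om th 0 1 ((-1) ^+ true * n%:R))); last first.
  by apply/funext => n; rewrite expr1 mulN1r.
rewrite !E => /(_ (@continuous_gauss_trig _ _ _ _ _ _) (integrable_gauss_trig _ _ _ _ c0)
  (cvg_gauss_sin om th false) (cvg_gauss_sin om th true)).
have ZI k P Q : mu.-integrable setT (EFin \o (fun t => k * gauss_trig c om th P Q t)).
  have := integrableZl measurableT k (integrable_gauss_trig om th P Q c0).
  by [].
under eq_Rintegral => t _.
  rewrite (_ : gauss_trig _ _ _ _ _ t = om * gauss_trig c om th 1 0 t +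
     (2 * c) * gauss_trig c om th 0 (- 'X) t); last first.
    rewrite /gauss_trig !horner0 !hornerN !hornerZ !hornerX !hornerC; ring.
  over.
rewrite RintegralD//.
rewrite !RintegralZl ?integrable_gauss_trig//.
rewrite -/(gauss_cos_transform th om) => h.
apply: (mulfI (x := 2 * c)); first by rewrite gt_eqF// mulr_gt0.
apply: (addrI (om * gauss_cos_transform th om)); rewrite h.
by field; rewrite gt_eqF.
Qed.

(** The differential equation says that the transform times
    exp (om^2 / (4 c)) is constant; its value at om = 0 is the Gaussian
    integral. *)
Lemma gauss_cos_transformE th om : gauss_cos_transform th om =
  cos th * Num.sqrt (pi / c) * gauss (4 * c)^-1 om.
Proof.
(* gauss with a negative parameter is the growing exponential. *)
  pose H x := gauss_cos_transform th x * gauss (- (4 * c)^-1) x.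
have dH x : is_derive x (1 : R) H 0.
  have h1 := is_derive_gauss_cos_transform th x.
  rewrite gauss_cos_transform_ode in h1.
  apply: is_derive_eq (is_deriveM h1 (is_derive_gauss _ x)) _.
  by rewrite /GRing.scale /=; field; rewrite gt_eqF.
have : H om = H 0 by exact: is_derive_0_is_cst.
rewrite /H => h.
have gV y : gauss (- (4 * c)^-1) y * gauss (4 * c)^-1 y = 1.
  by rewrite -gaussD addNr gauss0.
rewrite -[LHS]mulr1 -[X in _ * X = _](gV om) mulrA h; congr (_ * _).
rewrite [X in _ * X](_ : _ = 1); last first.
  by rewrite /gauss expr0n/= mulr0 oppr0 expR0.
rewrite mulr1 /gauss_cos_transform.
under eq_Rintegral => t _.
  rewrite (_ : gauss_trig _ _ _ _ _ t = cos th * gauss c t); last first.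
    rewrite /gauss_trig horner0 hornerC mul0r add0r; ring.
  over.
rewrite RintegralZl//; last exact: integrable_gauss.
by rewrite /Rintegral integral_gauss.
Qed.

Lemma gauss_fourier_cos om :
  \int[mu]_t (gauss c t * cos (om * t)) = Num.sqrt (pi / c) * gauss (4 * c)^-1 om.
Proof.
transitivity (gauss_cos_transform 0 om).
  apply: eq_Rintegral => t _.
  by rewrite /gauss_trig horner0 hornerC mul1r mul0r !addr0.
by rewrite gauss_cos_transformE cos0 mul1r.
Qed.

(** A sine is a cosine shifted by pi / 2, and the amplitude cos (- pi / 2)
    vanishes. *)
Lemma gauss_fourier_sin om : \int[mu]_t (gauss c t * sin (om * t)) = 0.
Proof.
transitivity (gauss_cos_transform (- (pi / 2)) om).
  apply: eq_Rintegral => t _.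
  by rewrite /gauss_trig horner0 hornerC mul1r mul0r addr0 cosBpihalf.
by rewrite gauss_cos_transformE cosN cos_pihalf !mul0r.
Qed.

End gauss_fourier.

(** * Wave packets and their transforms *)

Section waves.
Variables (R : realType) (L : R).
Hypothesis hL : 0 < L.
Implicit Types c t x om th tau : R.
Implicit Types m n j : int.
Let mu := @lebesgue_measure R.

Definition wavenumber m : R := 2 * pi * m%:~R / L.

Lemma wavenumberD m n : wavenumber (m + n) = wavenumber m + wavenumber n.
Proof. by rewrite /wavenumber intrD; field; rewrite gt_eqF. Qed.

Lemma wavenumberN m : wavenumber (- m) = - wavenumber m.
Proof. by rewrite /wavenumber mulrNz; field; rewrite gt_eqF. Qed.

Lemma wavenumber0 : wavenumber 0 = 0.
Proof. by rewrite /wavenumber mulr0 mul0r. Qed.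

Lemma wavenumber_neq0 m : m != 0 -> wavenumber m != 0.
Proof.
move=> m0; rewrite /wavenumber !mulf_neq0 ?intr_eq0 ?pnatr_eq0 ?invr_eq0//.
  by rewrite gt_eqF// pi_gt0.
by rewrite gt_eqF.
Qed.

Lemma cosD2piz (y : R) j : cos (y + 2 * pi * j%:~R) = cos y.
Proof.
have h (k : nat) (z : R) : cos (z + 2 * pi * k%:R) = cos z.
  rewrite -(periodicn (@cosD2pi R) k z) -mulr_natr -[pi *+ 2]mulr_natr.
  by congr cos; ring.
case: (intP j) => [|k|k]; rewrite ?mulr0 ?addr0//; first exact: (h k.+1).
by rewrite -[in RHS](subrK (2 * pi * k.+1%:R) y) h mulrNz mulrN.
Qed.

Lemma sinD2piz (y : R) j : sin (y + 2 * pi * j%:~R) = sin y.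
Proof. by rewrite -!cosBpihalf -addrAC cosD2piz. Qed.

Definition phase m om x t : R := wavenumber m * x + om * t.

Definition wave m om c x t : R[i] :=
  Complex (gauss c t * cos (phase m om x t)) (gauss c t * sin (phase m om x t)).

Lemma waveM m1 om1 c1 m2 om2 c2 :
  (fun x t => wave m1 om1 c1 x t * wave m2 om2 c2 x t) =
  wave (m1 + m2) (om1 + om2) (c1 + c2).
Proof.
apply/funext => x; apply/funext => t.
rewrite /wave [phase (_ + _) _ _ _](_ : _ = phase m1 om1 x t + phase m2 om2 x t).
  rewrite gaussD cosD sinD; apply/eqP; rewrite eq_complex /=.
  by apply/andP; split; apply/eqP; ring.
by rewrite /phase wavenumberD; ring.
Qed.

Lemma wave_conj m om c x t : conjc (wave m om c x t) = wave (- m) (- om) c x t.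
Proof.
rewrite /wave [phase (- _) _ _ _](_ : _ = - phase m om x t).
  by rewrite cosN sinN mulrN.
by rewrite /phase wavenumberN; ring.
Qed.

Lemma spaceY_wave m om c : 0 < c -> spaceY L (wave m om c).
Proof.
move=> c0; split=> [x t|x|t].
- rewrite /wave [phase m om (x + L) t](_ : _ = phase m om x t + 2 * pi * m%:~R).
    by rewrite cosD2piz sinD2piz.
  by rewrite /phase /wavenumber; field; rewrite gt_eqF.
- split.
  + rewrite (_ : (fun _ => _) = gauss_trig c om (wavenumber m * x) 1 0).
      exact: schwartz_gauss_trig.
    apply/funext => t; rewrite /gauss_trig horner0 hornerC mul1r mul0r addr0 /=.
    by rewrite /phase addrC.
  + rewrite (_ : (fun _ => _) = gauss_trig c om (wavenumber m * x) 0 1).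
      exact: schwartz_gauss_trig.
    apply/funext => t; rewrite /gauss_trig horner0 hornerC mul1r mul0r add0r /=.
    by rewrite /phase addrC.
- split.
  + rewrite (_ : (fun _ => _) =
      gauss_trig 0 (wavenumber m) (om * t) (gauss c t)%:P 0).
      exact: smooth_gauss_trig.
    apply/funext => x; rewrite /gauss_trig horner0 hornerC mul0r addr0 /=.
    by rewrite gauss0 mul1r.
  + rewrite (_ : (fun _ => _) =
      gauss_trig 0 (wavenumber m) (om * t) 0 (gauss c t)%:P).
      exact: smooth_gauss_trig.
    apply/funext => x; rewrite /gauss_trig horner0 hornerC mul0r add0r /=.
    by rewrite gauss0 mul1r.
Qed.

Lemma expi_wave th m om c x t y : phase m om x t - th = y ->
  expi (- th) * wave m om c x t = Complex (gauss c t * cos y) (gauss c t * sin y).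
Proof.
move=> <-; rewrite /wave /expi cosB sinB cosN sinN.
by apply/eqP; rewrite eq_complex /=; apply/andP; split; apply/eqP; ring.
Qed.

Lemma integral_cos_period m th :
  \int[mu]_(x in `[0, L]) cos (wavenumber m * x + th) =
  if m == 0 then L * cos th else 0.
Proof.
case: eqVneq => [->|m0].
  under eq_Rintegral do rewrite wavenumber0 mul0r add0r.
  rewrite Rintegral_cst//= lebesgue_measure_itv/= lte_fin hL -EFinB subr0/=.
  by rewrite mulrC.
have k0 := wavenumber_neq0 m0.
pose F x : R := (wavenumber m)^-1 *: sin (wavenumber m * x + th).
have dF x : is_derive x (1 : R) F (cos (wavenumber m * x + th)).
  have h := is_derive_sin_phase (wavenumber m) th x.
  apply: is_derive_eq (is_deriveZ (wavenumber m)^-1 h) _.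
  by rewrite /GRing.scale /= mulKf.
have cF : continuous F.
  by move=> x; apply/differentiable_continuous/derivable1_diffP; case: (dF x).
rewrite /Rintegral (@continuous_FTC2 _ _ F)//.
- rewrite -EFinB /F /= mulr0 add0r.
  have -> : wavenumber m * L + th = th + 2 * pi * m%:~R.
    by rewrite /wavenumber; field; rewrite gt_eqF.
  by rewrite sinD2piz subrr.
- apply: continuous_subspaceT => x.
  apply/differentiable_continuous/derivable1_diffP.
  by case: (is_derive_cos_phase (wavenumber m) th x).
- split.
  + by move=> x _; case: (dF x).
  + exact/cvg_at_right_filter/cF.
  + exact/cvg_at_left_filter/cF.
- by move=> x _; rewrite derive1E; case: (dF x).
Qed.

Lemma integral_sin_period m th :
  \int[mu]_(x in `[0, L]) sin (wavenumber m * x + th) =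
  if m == 0 then L * sin th else 0.
Proof.
under eq_Rintegral do rewrite -cosBpihalf -addrA.
by rewrite integral_cos_period cosBpihalf.
Qed.

Lemma integrable_cos_period m th :
  mu.-integrable `[0, L] (EFin \o (fun x => cos (wavenumber m * x + th))).
Proof.
apply: continuous_compact_integrable; first exact: segment_compact.
apply: continuous_subspaceT => x.
apply/differentiable_continuous/derivable1_diffP.
by case: (is_derive_cos_phase (wavenumber m) th x).
Qed.

Lemma integrable_sin_period m th :
  mu.-integrable `[0, L] (EFin \o (fun x => sin (wavenumber m * x + th))).
Proof.
apply: continuous_compact_integrable; first exact: segment_compact.
apply: continuous_subspaceT => x.
apply/differentiable_continuous/derivable1_diffP.
by case: (is_derive_sin_phase (wavenumber m) th x).
Qed.

(** Orthogonality of the characters of the circle of length L. *)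
Lemma fourier_coef_wave m om c n t : fourier_coef L (wave m om c) n t =
  if n == m then Complex (gauss c t * cos (om * t)) (gauss c t * sin (om * t))
  else 0.
Proof.
have E x : expi (- (2 * pi * n%:~R * x / L)) * wave m om c x t =
    Complex (gauss c t * cos (wavenumber (m - n) * x + om * t))
            (gauss c t * sin (wavenumber (m - n) * x + om * t)).
  apply: expi_wave; rewrite /phase wavenumberD wavenumberN /wavenumber.
  by field; rewrite gt_eqF.
rewrite /fourier_coef (funext E) /cintegral.
rewrite /= !RintegralZl//; last 2 first.
- exact: integrable_sin_period.
- exact: integrable_cos_period.
rewrite integral_cos_period integral_sin_period subr_eq0 [n == m]eq_sym.
case: eqP => _; last by rewrite mulr0 mulr0.
apply/eqP; rewrite eq_complex /= !mul0r subr0 addr0.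
by apply/andP; split; apply/eqP; field; rewrite gt_eqF.
Qed.

Lemma transformable_wave m om c : 0 < c -> transformable L (wave m om c).
Proof.
move=> c0 n; split.
- have [<-|nm] := eqVneq n m.
  + have := integrable_gauss_trig om 0 1 0 c0.
    apply: eq_integrable => // t _; rewrite fourier_coef_wave eqxx /=.
    by rewrite /gauss_trig horner0 hornerC mul1r mul0r !addr0.
  + have := integrable0 mu setT; apply: eq_integrable => // t _.
    by rewrite fourier_coef_wave (negbTE nm).
- have [<-|nm] := eqVneq n m.
  + have := integrable_gauss_trig om 0 0 1 c0.
    apply: eq_integrable => // t _; rewrite fourier_coef_wave eqxx /=.
    by rewrite /gauss_trig horner0 hornerC mul1r mul0r !addr0 add0r.
  + have := integrable0 mu setT; apply: eq_integrable => // t _.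
    by rewrite fourier_coef_wave (negbTE nm).
Qed.

Lemma fourier_transform_wave m om c tau n : 0 < c ->
  fourier_transform L (wave m om c) tau n =
  if n == m then real_complex R (Num.sqrt (pi / c) * gauss (4 * c)^-1 (tau - om))
  else 0.
Proof.
move=> c0; rewrite /fourier_transform /cintegral.
have -> : fourier_coef L (wave m om c) n = fun t => if n == m then
    Complex (gauss c t * cos (om * t)) (gauss c t * sin (om * t)) else 0.
  by apply/funext => t; exact: fourier_coef_wave.
have I0 (g : R -> R) : (forall t, g t = 0) -> \int[mu]_t g t = 0.
  by move=> g0; rewrite /Rintegral integral0_eq// => t _; rewrite g0.
case: eqP => _; last by rewrite !I0// => t /=; ring.
apply/eqP; rewrite eq_complex; apply/andP; split; apply/eqP => /=.
- have -> : gauss (4 * c)^-1 (tau - om) = gauss (4 * c)^-1 (om - tau).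
    by rewrite /gauss -sqrrN opprB.
  rewrite -gauss_fourier_cos//; apply: eq_Rintegral => t _ /=.
  by rewrite mulrBl cosB (mulrC t) cosN sinN; ring.
- rewrite -[RHS](gauss_fourier_sin c0 (om - tau)); apply: eq_Rintegral => t _ /=.
  by rewrite mulrBl sinB (mulrC t) cosN sinN; ring.
Qed.

End waves.

(** * Norms of wave packets *)

Section norms.
Variables (R : realType) (L : R).
Hypothesis hL : 0 < L.
Implicit Types c t x om th tau e b s K W : R.
Implicit Types m n j : int.
Let mu := @lebesgue_measure R.

Lemma weighted_norm_wave w m om c : 0 < c ->
  weighted_norm L w (wave L m om c) =
  Lnorm mu 2%:E (fun tau =>
    (w tau m * (Num.sqrt (pi / c) * gauss (4 * c)^-1 (tau - om)))%:E).
Proof.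
move=> c0; rewrite /weighted_norm asboolT; last exact: transformable_wave.
have E n : (Lnorm mu 2%:E (fun tau =>
      (w tau n * Normc.normc (fourier_transform L (wave L m om c) tau n))%:E)
      `^ 2)%E =
    if n \in [set m] then (Lnorm mu 2%:E (fun tau =>
      (w tau n * (Num.sqrt (pi / c) * gauss (4 * c)^-1 (tau - om)))%:E) `^ 2)%E
    else 0%E.
  case: ifPn => [|nm].
    rewrite inE => ->; congr (_ `^ 2)%E; apply: eq_Lnorm => tau; cbv beta.
    rewrite fourier_transform_wave// eqxx /= expr0n/= addr0 sqrtr_sqr.
    by rewrite ger0_norm// mulr_ge0 ?sqrtr_ge0 ?gauss_ge0.
  rewrite -(@poweR0r _ 2) ?pnatr_eq0//; congr (_ `^ 2)%E.
  rewrite -(@Lnorm0 _ _ _ mu 2%:E) ?eqe ?pnatr_eq0//; apply: eq_Lnorm => tau; cbv beta.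
  have {}nm : n == m = false by apply/negbTE; apply: contraNneq nm => ->; rewrite inE.
  by rewrite fourier_transform_wave// nm /= expr0n/= addr0 sqrtr0 mulr0.
under eq_esum do rewrite E.
rewrite -esum_mkcond esum_set1; last exact: poweR_ge0.
by rewrite -poweRrM divff ?pnatr_eq0// poweRe1// Lnorm_ge0.
Qed.

Lemma Lnorm2_gauss K e om : 0 <= K -> 0 < e ->
  Lnorm mu 2%:E (fun tau => (K * gauss e (tau - om))%:E) =
  (K * Num.sqrt (Num.sqrt (pi / (2 * e))))%:E.
Proof.
move=> K0 e0; rewrite unlock /Lnorm.
under eq_integral => tau _.
  rewrite (_ : (_ `^ 2)%E = ((K ^+ 2)%:E * (gauss (2 * e) (tau - om))%:E)%E).
    over.
  rewrite /= ger0_norm ?mulr_ge0 ?gauss_ge0//.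
  rewrite -EFinM powR_mulrn ?mulr_ge0 ?gauss_ge0//; congr EFin.
  by rewrite mulr_natl mulr2n gaussD exprMn.
have e20 : 0 < 2 * e by rewrite mulr_gt0.
rewrite ge0_integralZl//; last 3 first.
- apply/measurable_EFinP; apply: measurableT_comp; first exact: measurable_gauss.
  exact: measurable_funB.
- by move=> tau _; rewrite lee_fin gauss_ge0.
- by rewrite lee_fin sqr_ge0.
rewrite integral_gauss_center// -EFinM poweR_EFin powR12_sqrt; last first.
  by rewrite mulr_ge0 ?sqr_ge0 ?sqrtr_ge0.
by rewrite sqrtrM ?sqr_ge0// sqrtr_sqr ger0_norm.
Qed.

Lemma le_Lnorm2 (f g : R -> R) : measurable_fun setT f -> measurable_fun setT g ->
  (forall x, 0 <= f x <= g x) ->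
  (Lnorm mu 2%:E (EFin \o f) <= Lnorm mu 2%:E (EFin \o g))%E.
Proof.
move=> mf mg fg; rewrite unlock /Lnorm.
have mp (h : R -> R) : measurable_fun setT h ->
    measurable_fun setT (fun x => (`|(EFin \o h) x| `^ 2)%E).
  move=> mh; rewrite (_ : (fun _ => _) = EFin \o (fun x => `|h x| `^ 2))//.
  apply/measurable_EFinP; apply: (measurableT_comp (measurable_powR _)).
  exact: measurableT_comp.
apply: gt0_ler_poweR; rewrite ?invr_ge0 ?in_itv/= ?leey ?andbT//.
- by apply: integral_ge0 => x _; rewrite lee_fin powR_ge0.
- by apply: integral_ge0 => x _; rewrite lee_fin powR_ge0.
apply: ge0_le_integral => //; [exact: mp|exact: mp|].
move=> x _; have /andP[f0 fgx] := fg x.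
rewrite /= lee_fin ge0_ler_powR ?nnegrE// !ger0_norm//.
exact: le_trans fgx.
Qed.

Lemma bracket_gt0 (x : R) : 0 < bracket x.
Proof. by rewrite /bracket ltr_wpDr. Qed.

Lemma bracket_ge1 (x : R) : 1 <= bracket x.
Proof. by rewrite /bracket lerDl. Qed.

(** A power of a bracket, of either sign, lies between a Gaussian and the
    inverse of a Gaussian: |b| is below some natural number M, and
    (1 + D + |x|)^M exp (- e x^2) is bounded. *)
Lemma bracket_powR_gauss e D b : 0 < e -> 0 <= D -> exists C, 0 < C /\
  forall a x, `|a| <= `|x| + D ->
    C^-1 * gauss e x <= bracket a `^ b <= C * gauss (- e) x.
Proof.
move=> e0 D0; pose M := (Num.truncn `|b|).+1.
have bM : `|b| <= M%:R by exact/ltW/truncnS_gt.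
have [C hC] := horner_gauss_bounded (((1 + D)%:P + 'X) ^+ M) e0.
exists (`|C| + 1); split; first by rewrite ltr_wpDl.
move=> a x ax; have C0 : 0 < `|C| + 1 by rewrite ltr_wpDl.
have ba1 := bracket_ge1 a.
have b0 := bracket_gt0 a.
have gV : gauss e x * gauss (- e) x = 1 by rewrite -gaussD subrr gauss0.
have key : bracket a ^+ M <= (`|C| + 1) * gauss (- e) x.
  rewrite -(ler_pM2r (gauss_gt0 e x)) -mulrA [gauss (- e) x * _]mulrC gV mulr1.
  apply: (@le_trans _ _ (`|(((1 + D)%:P + 'X) ^+ M).[`|x|]| * gauss e `|x|)).
    have -> : gauss e `|x| = gauss e x by rewrite /gauss real_normK ?num_real.
    rewrite ler_wpM2r ?gauss_ge0//; apply: le_trans (ler_norm _).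
    rewrite horner_exp !hornerE lerXn2r ?nnegrE ?(ltW b0)//.
      by rewrite !addr_ge0.
    by rewrite /bracket -addrA lerD2l addrC.
  apply: le_trans (hC _) _; apply: le_trans (ler_norm _) _; by rewrite lerDl.
apply/andP; split.
- have -> : (`|C| + 1)^-1 * gauss e x = ((`|C| + 1) * gauss (- e) x)^-1.
    rewrite invfM; congr (_ * _); apply: (mulIf (lt0r_neq0 (gauss_gt0 (- e) x))).
    by rewrite gV mulVf// gt_eqF// gauss_gt0.
  apply: (@le_trans _ _ (bracket a ^+ M)^-1).
    by rewrite lef_pV2// posrE ?exprn_gt0// mulr_gt0// gauss_gt0.
  rewrite -powR_invn ?(ltW b0)//; apply: ler_powR => //.
  by rewrite lerNl; apply: le_trans bM; rewrite -normrN ler_norm.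
- apply: le_trans key; rewrite -powR_mulrn ?(ltW b0)//.
  apply: ler_powR => //; exact: le_trans (ler_norm _) bM.
Qed.

(** The transform of the packet is the Gaussian of parameter 2 e, with
    e = 1 / (8 c), up to a constant.  The weight costs at most a constant times
    exp (e (tau - om)^2), up or down, so that the product lies between
    multiples of the Gaussians of parameters 3 e and e centred at om, whose
    norms do not depend on om. *)
Lemma weighted_norm_wave_bounds c D b : 0 < c -> 0 <= D ->
  exists A B : R, [/\ 0 < A, 0 < B &
  forall (w : R -> int -> R) (a : R -> R) (W : R) m om,
    measurable_fun setT a -> (forall tau, `|a tau| <= `|tau - om| + D) ->
    0 <= W -> (forall tau, w tau m = bracket (a tau) `^ b * W) ->
    ((A * W)%:E <= weighted_norm L w (wave L m om c) <= (B * W)%:E)%E].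
Proof.
move=> c0 D0; pose e := (8 * c)^-1.
have e0 : 0 < e by rewrite invr_gt0 mulr_gt0.
have e30 : 0 < 3 * e by rewrite mulr_gt0.
have [C [C0 hC]] := bracket_powR_gauss b e0 D0.
pose S := Num.sqrt (pi / c).
have S0 : 0 < S by rewrite sqrtr_gt0 divr_gt0// pi_gt0.
pose Q d : R := Num.sqrt (Num.sqrt (pi / (2 * d))).
have Q0 d : 0 < d -> 0 < Q d.
  by move=> d0; rewrite !sqrtr_gt0 divr_gt0 ?pi_gt0// mulr_gt0.
have ge y : gauss (4 * c)^-1 y = gauss e y * gauss e y.
  have -> : (4 * c)^-1 = e + e by rewrite /e; field; rewrite gt_eqF.
  exact: gaussD.
have gV y : gauss (- e) y * gauss e y = 1 by rewrite -gaussD addNr gauss0.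
have g3 y : gauss (3 * e) y = gauss e y * (gauss e y * gauss e y).
  have -> : 3 * e = e + (e + e) by ring.
  by rewrite !gaussD.
exists (C^-1 * S * Q (3 * e)), (C * S * Q e); split.
- by rewrite !mulr_gt0 ?invr_gt0// Q0.
- by rewrite !mulr_gt0// Q0.
move=> w a W m om ma ha W0 hw.
have mg d : measurable_fun setT (fun tau => gauss d (tau - om)).
  apply: measurableT_comp; first exact: measurable_gauss.
  exact: measurable_funB.
have mw : measurable_fun setT (fun tau =>
    w tau m * (S * gauss (4 * c)^-1 (tau - om))).
  apply: measurable_funM; last by apply: measurable_funM.
  rewrite (_ : (fun _ => _) = fun tau => bracket (a tau) `^ b * W); last first.
    exact/funext.
  apply: measurable_funM => //; apply: (measurableT_comp (measurable_powR _)).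
  by apply: measurable_funD => //; exact: measurableT_comp.
rewrite weighted_norm_wave//; apply/andP; split.
- rewrite [X in X%:E](_ : _ = C^-1 * S * W * Q (3 * e)); last by ring.
  rewrite -(@Lnorm2_gauss _ _ om)//; last by rewrite !mulr_ge0 ?invr_ge0// ltW.
  apply: le_Lnorm2 => //; first exact: measurable_funM.
  move=> tau; have /andP[h _] := hC _ _ (ha tau).
  rewrite !mulr_ge0 ?invr_ge0 ?gauss_ge0 ?(ltW C0) ?(ltW S0)//= hw g3 ge.
  rewrite [leLHS](_ : _ = (C^-1 * gauss e (tau - om)) *
    (W * (S * (gauss e (tau - om) * gauss e (tau - om))))); last by ring.
  by rewrite -[leRHS]mulrA ler_wpM2r// !mulr_ge0 ?gauss_ge0// ltW.
- rewrite [X in (_ <= X%:E)%E](_ : _ = C * S * W * Q e); last by ring.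
  rewrite -(@Lnorm2_gauss _ _ om)//; last by rewrite !mulr_ge0// ltW.
  apply: le_Lnorm2 => //; first exact: measurable_funM.
  move=> tau; have /andP[_ h] := hC _ _ (ha tau).
  rewrite hw !mulr_ge0 ?powR_ge0 ?gauss_ge0 ?(ltW S0)//= ge.
  rewrite [leRHS](_ : _ = (C * gauss (- e) (tau - om)) *
    (W * (S * (gauss e (tau - om) * gauss e (tau - om))))).
    by rewrite -[leLHS]mulrA ler_wpM2r// !mulr_ge0 ?gauss_ge0// ltW.
  by rewrite -[LHS]mulr1 -(gV (tau - om)); ring.
Qed.

Lemma XS_norm_wave_bounds c b : 0 < c -> exists A B : R, [/\ 0 < A, 0 < B &
  forall k m om, om = - wavenumber L m ^+ 2 ->
    ((A * bracket m%:~R `^ k)%:E <= XS_norm L k b (wave L m om c)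
       <= (B * bracket m%:~R `^ k)%:E)%E].
Proof.
move=> c0; have [A [B [A0 B0 h]]] := weighted_norm_wave_bounds b c0 (lexx 0).
exists A, B; split=> // k m om ->.
apply: (h _ (fun tau => tau + wavenumber L m ^+ 2)) => //.
- exact: measurable_funD.
- by move=> tau; rewrite opprK addr0.
- exact: powR_ge0.
Qed.

(** With y = m^2, this is y <= sqrt (y + y^2) <= y + 1: the Boussinesq
    dispersion relation is a bounded perturbation of the Schroedinger one. *)
Lemma gammaL_wavenumber m :
  `|wavenumber L m ^+ 2 - gammaL L m| <= (2 * pi / L) ^+ 2.
Proof.
have -> : wavenumber L m ^+ 2 = (2 * pi / L) ^+ 2 * m%:~R ^+ 2.
  by rewrite /wavenumber; field; rewrite gt_eqF.
rewrite /gammaL -mulrBr normrM ger0_norm ?sqr_ge0// ler_piMr ?sqr_ge0//.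
set y : R := m%:~R ^+ 2; have y0 : 0 <= y by exact: sqr_ge0.
have -> : m%:~R ^+ 4 = y ^+ 2 :> R by rewrite -exprM.
rewrite distrC ger0_norm.
  rewrite lerBlDl -[leRHS]ger0_norm ?addr_ge0// -sqrtr_sqr ler_wsqrtr//.
  by nra.
rewrite subr_ge0 -[leLHS]ger0_norm// -sqrtr_sqr ler_wsqrtr//.
by rewrite lerDr.
Qed.

Lemma XB_norm_wave_bounds c b : 0 < c -> exists A B : R, [/\ 0 < A, 0 < B &
  forall s m om, `|om| = wavenumber L m ^+ 2 ->
    ((A * bracket m%:~R `^ s)%:E <= XB_norm L s b (wave L m om c)
       <= (B * bracket m%:~R `^ s)%:E)%E].
Proof.
move=> c0.
have [A [B [A0 B0 h]]] := weighted_norm_wave_bounds b c0 (sqr_ge0 (2 * pi / L)).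
exists A, B; split=> // s m om hom.
apply: (h _ (fun tau => `|tau| - gammaL L m)) => //.
- by apply: measurable_funB => //; exact: measurableT_comp.
- move=> tau.
  rewrite (_ : _ - _ = (`|tau| - `|om|) + (wavenumber L m ^+ 2 - gammaL L m)).
    rewrite (le_trans (ler_normD _ _))// lerD ?gammaL_wavenumber//.
    exact: ler_dist_dist.
  by rewrite hom; ring.
- exact: powR_ge0.
Qed.

End norms.

(** If q < p then (1 + N)^(p - q), which is unbounded, would be at most
    B / A. *)
Lemma powR_bracket_le_exponent (R : realType) (A B p q : R) : 0 < A ->
  (forall N : nat, A * bracket (N%:~R : R) `^ p <= B * bracket (N%:~R : R) `^ q) ->
  p <= q.
Proof.
move=> A0 h; rewrite leNgt; apply/negP => qp.
have d0 : 0 < p - q by rewrite subr_gt0.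
have bnd (N : nat) : bracket (N%:~R : R) `^ (p - q) <= B / A.
  rewrite ler_pdivlMr// powRB; last by rewrite gt_eqF//= gt_eqF// bracket_gt0.
  rewrite mulrAC ler_pdivrMr ?powR_gt0 ?bracket_gt0//.
  by rewrite mulrC.
pose y : R := `|B / A| + 1.
have y0 : 0 < y by rewrite ltr_wpDl.
pose N := (Num.truncn (y `^ (p - q)^-1)).+1.
have hN : y `^ (p - q)^-1 <= bracket (N%:~R : R).
  rewrite (le_trans (ltW (truncnS_gt _)))// /bracket ger0_norm.
    by rewrite ler_wpDl.
  by [].
have := ge0_ler_powR (ltW d0) (powR_ge0 _ _) (ltW (bracket_gt0 _)) hN.
rewrite -powRrM mulVf ?gt_eqF// powRr1 ?(ltW y0)// => h2.
have := le_trans h2 (bnd N); rewrite /y => h3.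
have := ler_norm (B / A); lra.
Qed.

(** * Resonant interactions *)

Lemma le_of_lee_mul (R : realType) (A c x y : R) (P X Y : \bar R) :
  0 < c -> (A%:E <= P)%E -> (P <= c%:E * (X * Y))%E ->
  (0 <= X <= x%:E)%E -> (0 <= Y <= y%:E)%E -> A <= c * (x * y).
Proof.
move=> c0 AP PXY /andP[X0 Xx] /andP[Y0 Yy]; rewrite -lee_fin !EFinM.
apply: le_trans AP (le_trans PXY _).
by rewrite lee_wpmul2l ?lee_fin ?(ltW c0)// lee_pmul.
Qed.

Lemma lee_between (R : realType) (A B : R) (X : \bar R) : 0 <= A ->
  (A%:E <= X <= B%:E)%E -> (0 <= X <= B%:E)%E /\ (X < +oo)%E.
Proof.
move=> A0 /andP[AX XB]; split; last exact: le_lt_trans XB (ltry _).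
by rewrite XB andbT (le_trans _ AX).
Qed.

Lemma bracket0 (R : realType) : bracket (0%:~R : R) = 1.
Proof. by rewrite /bracket normr0 addr0. Qed.

Section necessary_conditions.
Variables (R : realType) (L : R).
Hypothesis hL : 0 < L.
Variables (k s a b : R).

(** S and B are the Schroedinger and Boussinesq spaces of the two factors, in
    order. *)
Definition SB_estimate := exists c : R, 0 < c /\
  forall u v : R -> R -> R[i], spaceY L u -> spaceY L v ->
    (XS_norm L k b u < +oo)%E -> (XB_norm L s b v < +oo)%E ->
    (XS_norm L k (- a) (fun x t => (u x t * v x t)%R)
       <= c%:E * (XS_norm L k b u * XB_norm L s b v))%E.

Definition SS_estimate := exists c : R, 0 < c /\
  forall u1 u2 : R -> R -> R[i], spaceY L u1 -> spaceY L u2 ->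
    (XS_norm L k b u1 < +oo)%E -> (XS_norm L k b u2 < +oo)%E ->
    (XB_norm L s (- a) (fun x t => (u1 x t * conjc (u2 x t))%R)
       <= c%:E * (XS_norm L k b u1 * XS_norm L k b u2))%E.

(** Time frequency of the free Schroedinger wave of space frequency N. *)
Let free (N : int) : R := - wavenumber L N ^+ 2.

(** The estimate tested on a resonant interaction: by the condition on
    free (m + n) the product again solves the free Schroedinger equation up to
    its Gaussian envelope.  The product has envelope exp (- 2 t^2), whence the
    parameter 1 + 1. *)
Lemma SB_estimate_bracket : SB_estimate -> exists A B : R, 0 < A /\
  forall (m n : int) (om : R), `|om| = wavenumber L n ^+ 2 ->
    free (m + n) = free m + om ->
    A * bracket (m + n)%:~R `^ k <=
    B * (bracket m%:~R `^ k * bracket n%:~R `^ s).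
Proof.
move=> [c [c0 est]].
have c11 : (0 : R) < 1 + 1 by rewrite addr_gt0.
have [A [B0 [A0 _ hA]]] := XS_norm_wave_bounds hL (- a) c11.
have [A1 [B1 [A10 B10 h1]]] := XS_norm_wave_bounds hL b (@ltr01 R).
have [A2 [B2 [A20 B20 h2]]] := XB_norm_wave_bounds hL b (@ltr01 R).
exists A, (c * (B1 * B2)); split=> // m n om hom hres.
have [Xb Xoo] := lee_between (mulr_ge0 (ltW A10) (powR_ge0 _ _)) (h1 k m _ erefl).
have [Yb Yoo] := lee_between (mulr_ge0 (ltW A20) (powR_ge0 _ _)) (h2 s n om hom).
have := est _ _ (spaceY_wave hL _ _ (@ltr01 R)) (spaceY_wave hL _ _ (@ltr01 R)) Xoo Yoo.
rewrite waveM// => PXY.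
have /andP[AP _] := hA k (m + n) _ (esym hres).
have := le_of_lee_mul c0 AP PXY Xb Yb.
by move=> /le_trans; apply; rewrite le_eqVlt; apply/orP; left; apply/eqP; ring.
Qed.

(** A packet u at frequency zero leaves the frequencies of v unchanged: the
    product carries the weight k at frequency N, and v the weight s. *)
Lemma SB_estimate_le : SB_estimate -> k <= s.
Proof.
move=> /SB_estimate_bracket[A [B [A0 h]]].
apply: (powR_bracket_le_exponent (B := B) A0) => N.
have := h 0 N (free N).
rewrite add0r bracket0 powR1 mul1r; apply.
- by rewrite normrN ger0_norm ?sqr_ge0.
- by rewrite /free wavenumber0 expr0n/= oppr0 add0r.
Qed.

(** Opposite high frequencies cancel in the product; the Boussinesq norm, which
    sees the time frequency through its absolute value, allows the opposite time
    frequency too. *)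
Lemma SB_estimate_add_ge0 : SB_estimate -> 0 <= k + s.
Proof.
move=> /SB_estimate_bracket[A [B [A0 h]]].
apply: (powR_bracket_le_exponent (B := B) A0) => N.
have := h N (- N%:Z) (wavenumber L N ^+ 2).
rewrite subrr bracket0 powR1 powRr0 powRD; last first.
  by apply/implyP => _; rewrite gt_eqF ?bracket_gt0.
rewrite [bracket (- _)%:~R](_ : _ = bracket N%:~R); last first.
  by rewrite /bracket mulrNz normrN.
apply.
- by rewrite wavenumberN// sqrrN ger0_norm ?sqr_ge0.
- by rewrite /free wavenumber0 expr0n/= oppr0 addNr.
Qed.

(** Multiplying by the conjugate of a packet at frequency zero keeps both
    frequencies of the other factor. *)
Lemma SS_estimate_le : SS_estimate -> s <= k.
Proof.
move=> [c [c0 est]].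
have c11 : (0 : R) < 1 + 1 by rewrite addr_gt0.
have [A [B0 [A0 _ hA]]] := XB_norm_wave_bounds hL (- a) c11.
have [A1 [B1 [A10 B10 h1]]] := XS_norm_wave_bounds hL b (@ltr01 R).
apply: (powR_bracket_le_exponent (B := c * (B1 * B1)) A0) => N.
have [Xb Xoo] := lee_between (mulr_ge0 (ltW A10) (powR_ge0 _ _)) (h1 k N _ erefl).
have [Yb Yoo] := lee_between (mulr_ge0 (ltW A10) (powR_ge0 _ _)) (h1 k 0 _ erefl).
have := est _ _ (spaceY_wave hL _ _ (@ltr01 R)) (spaceY_wave hL _ _ (@ltr01 R)) Xoo Yoo.
under eq_fun do under eq_fun do rewrite wave_conj//.
rewrite waveM// => PXY.
have hom : `|free N + - free 0| = wavenumber L (N%:Z + - 0) ^+ 2.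
  rewrite /free wavenumber0 expr0n/= !oppr0 !addr0.
  by rewrite normrN ger0_norm ?sqr_ge0.
have /andP[AP _] := hA s _ _ hom.
have := le_of_lee_mul c0 AP PXY Xb Yb.
rewrite oppr0 addr0 bracket0 powR1 mulr1 => /le_trans; apply.
by rewrite le_eqVlt; apply/orP; left; apply/eqP; ring.
Qed.

End necessary_conditions.

Theorem theorem1p3 (R : realType) (L : R) (hL : 0 < L) (k s a b : R) :
  [/\ (exists c : R, 0 < c /\
        forall u v : R -> R -> R[i], spaceY L u -> spaceY L v ->
          (XS_norm L k b u < +oo)%E -> (XB_norm L s b v < +oo)%E ->
          (XS_norm L k (- a) (fun x t => (u x t * v x t)%R)
             <= c%:E * (XS_norm L k b u * XB_norm L s b v))%E) ->
      k <= s,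
      (exists c : R, 0 < c /\
        forall u v : R -> R -> R[i], spaceY L u -> spaceY L v ->
          (XS_norm L k b u < +oo)%E -> (XB_norm L s b v < +oo)%E ->
          (XS_norm L k (- a) (fun x t => (u x t * v x t)%R)
             <= c%:E * (XS_norm L k b u * XB_norm L s b v))%E) ->
      0 <= k + s &
      (exists c : R, 0 < c /\
        forall u1 u2 : R -> R -> R[i], spaceY L u1 -> spaceY L u2 ->
          (XS_norm L k b u1 < +oo)%E -> (XS_norm L k b u2 < +oo)%E ->
          (XB_norm L s (- a) (fun x t => (u1 x t * conjc (u2 x t))%R)
             <= c%:E * (XS_norm L k b u1 * XS_norm L k b u2))%E) ->
      s <= k].
Proof.
split; [exact: SB_estimate_le|exact: SB_estimate_add_ge0|exact: SS_estimate_le].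
Qed.
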